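(* Let $\mathbb{M}=(\mathbf{M}^{k})_{k=0,\dots,N}$ be an admissible flat stratification of $\mathbb{R}^N$ and let $(A^{k,j},b^{k,j},c^{k,j},\ell^{k,j})$ be control data on its connected components $\mathbf{M}^{k,j}$ satisfying the standing assumptions listed in the context, with $\bar c>0$ the lower bound for the discount factors appearing there. Let $\Delta x>0$, let $\mathcal{T}^{\Delta x}$ be a non-degenerate triangulation of $\mathbb{R}^N$ adapted to the stratification, and let $h\in(0,1/\bar c)$. Then there exists a unique bounded solution $u_{h,\Delta x}\in W^{\Delta x}$ of $$u(x_\sigma)=\min_{(k,j)\in L(x_\sigma)}\ \inf_{\alpha\in A^{k,j}}\Big\{(1-c^{k,j}h)\sum_{\tau\in\mathbb{N}}\beta_\tau\big(x_\sigma+h\,b^{k,j}(x_\sigma,\alpha)\big)u(x_\tau)+h\,\ell^{k,j}(x_\sigma,\alpha)\Big\},\qquad x_\sigma\in X^{\Delta x}.$$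
   Context: **Admissible flat stratification.** $\mathbb{R}^N$ is the disjoint union of sets $\mathbf{M}^0,\dots,\mathbf{M}^N$ such that, for each $k$: (i) for every $x\in\mathbf{M}^k$ there are $r>0$ and a $k$-dimensional linear subspace $V_k$ of $\mathbb{R}^N$ with $B(x,r)\cap\mathbf{M}^k=B(x,r)\cap(x+V_k)$, and $B(x,r)\cap\mathbf{M}^l=\emptyset$ if $l<k$; (ii) if $\mathbf{M}^k\cap\overline{\mathbf{M}^l}\ne\emptyset$ for some $l>k$, then $\mathbf{M}^k\subset\overline{\mathbf{M}^l}$; (iii) $\overline{\mathbf{M}^k}\subset\mathbf{M}^0\cup\dots\cup\mathbf{M}^k$. For $x\in\mathbf{M}^k$, $T_x\mathbf{M}^k=V_k$. Write $\mathbf{M}^k=\bigcup_{j=1}^{J(k)}\mathbf{M}^{k,j}$, $J(k)\in\mathbb{N}$, for the decomposition into connected components, and $L(x)=\{(k,j): x\in\overline{\mathbf{M}^{k,j}}\}$. **Control data and standing assumptions.** On each $\mathbf{M}^{k,j}$ there are given a control set $A^{k,j}$, a dynamics $b^{k,j}:\mathbb{R}^N\times A^{k,j}\to\mathbb{R}^N$ with $b^{k,j}(x,\alpha)\in T_x\mathbf{M}^k$ for $(x,\alpha)\in\mathbf{M}^{k,j}\times A^{k,j}$, a constant discount factor $c^{k,j}\in\mathbb{R}$ and a running cost $\ell^{k,j}:\mathbb{R}^N\times A^{k,j}\to\mathbb{R}$, such that: (a) $b^{k,j},\ell^{k,j}$ are bounded and continuous on $\mathbb{R}^N\times A^{k,j}$;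 the sets $\{(b^{k,j},\ell^{k,j})(x,\alpha):\alpha\in A^{k,j}\}$ are convex compact subsets of $\mathbb{R}^{N+1}$; for every $R>0$ there is $C_R$ with $|b^{k,j}(x,\alpha)-b^{k,j}(y,\alpha)|\le C_R|x-y|$ for all $x,y\in B(0,R)$, $\alpha\in A^{k,j}$; (b) there is a constant $\bar c>0$ with $c^{k,j}\ge\bar c$ for all $(k,j)$; (c) (normal controllability) for $x\in\mathbf{M}^{\bar k}$, the closed convex hull of the union over $(k,j)\in L(x)$, $k>\bar k$, of the sets $\{(b^{k,j}(x,\alpha),\ell^{k,j}(x,\alpha)):\alpha\in A^{k,j}\}$ satisfies the following controllability condition: there is $\delta>0$ such that, for $0\le\bar k<N$ and $x\in\mathbf{M}^{\bar k}$, with $r,V_{\bar k}$ as in (i), every $y\in B(x,r)\setminus\mathbf{M}^{\bar k}$ satisfies $B(0,\delta)\cap V_{\bar k}^\perp\subset\mathbf{B}(y)\cap V_{\bar k}^\perp$, where $\mathbf{B}(y)$ is the set of the dynamics $b$ occurring in the corresponding hull at $y$ (at such $y$ only strata of dimension $k>\bar k$ occur). **Discretization.** $\mathcal{T}^{\Delta x}=\{S_\tau^{\Delta x}\}_{\tau\in\mathbb{N}}$ is a triangulation of $\mathbb{R}^N$ by $N$-simplices covering $\mathbb{R}^N$, non-degenerate: $\sup_\tau\mathrm{diam}\,S_\tau^{\Delta x}\le\Delta x$ and $\rho\,\Delta x\le\inf_\tau\mathrm{diam}\,B_{S_\tau^{\Delta x}}$ for some $\rho\in(0,1)$, where $B_S$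 is the greatest ball contained in $S$. $X^{\Delta x}=\{x_\sigma\}_{\sigma\in\mathbb{N}}$ is its set of vertices; $W^{\Delta x}$ is the space of continuous functions on $\mathbb{R}^N$ whose gradient is constant in every simplex; $\beta_\sigma\in W^{\Delta x}$ are the basis functions with $\beta_\sigma(x_\tau)=\delta_{\sigma\tau}$; they satisfy $0\le\beta_\sigma\le1$, $\sum_\sigma\beta_\sigma=1$, at most $N+1$ of them are non-zero at any point, and $w=\sum_\sigma\beta_\sigma w(x_\sigma)$ for $w\in W^{\Delta x}$. The triangulation is adapted to the stratification: if $x\in\mathbf{M}^k$ and $\beta_\sigma(x)\ne0$, then $x_\sigma\in\overline{\mathbf{M}^k}$; that is, it induces a triangulation of size $\Delta x$ of each $\overline{\mathbf{M}^k}$, and points of $\mathbf{M}^0$ are vertices.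
   Formalization: The formal theorem additionally assumes c^{k,j}h < 2 for all (k,j); since \bar c is only a lower bound, h < 1/\bar c does not ensure this, and uniqueness can fail when c^{k,j}h = 2. *)

(* Defs.v *)
From mathcomp Require Import all_boot all_order all_algebra.
From mathcomp Require Import all_classical all_reals all_analysis.
Import Order.TTheory GRing.Theory Num.Theory.
Import numFieldNormedType.Exports.

Set Implicit Arguments.
Unset Strict Implicit.
Unset Printing Implicit Defensive.

Local Open Scope classical_set_scope.
Local Open Scope ring_scope.

(* The library norm on 'rV[R]_N is the sup norm; it induces the usual topology,
   but balls, distances and diameters below are Euclidean. *)
Section Euclidean.
Context {R : realType} {N : nat}.
Implicit Types (x y v : 'rV[R]_N) (A : set 'rV[R]_N).

Definition dotp x y : R := \sum_(i < N) x 0 i * y 0 i.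

Definition enorm x : R := Num.sqrt (dotp x x).

Definition eball x (r : R) : set 'rV[R]_N := [set y | enorm (y - x) < r].

Definition diam A : R := sup [set enorm (x - y) | x in A & y in A].

Definition orthogonal_complement (V : {vspace 'rV[R]_N}) : set 'rV[R]_N :=
  [set v | forall w, w \in V -> dotp v w = 0].

End Euclidean.

Definition closed_convex_hull {R : realType} (E : normedModType R)
    (U : set E) : set E :=
  smallest [set A : set E | closed A /\ convex_set (A : set (convex_lmodType E))] U.

(* Index of M^{k,j}; j runs over 0, ..., J(k) - 1, and J(k) = 0 exactly when
   M^k is empty. *)
Notation comp_index J := {k : _ & 'I_(J k)}.

Section Stratification.
Context {R : realType} {N : nat}.
Implicit Types (M : 'I_N.+1 -> set 'rV[R]_N) (k : 'I_N.+1) (x : 'rV[R]_N).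

Definition flat_at M k x (r : R) (V : {vspace 'rV[R]_N}) : Prop :=
  [/\ 0 < r,
      \dim V = k,
      eball x r `&` M k = eball x r `&` [set y | y - x \in V] &
      forall l : 'I_N.+1, (l < k)%N -> eball x r `&` M l = set0].

Record admissible_flat_stratification M : Prop := {
  strat_cover : \bigcup_k M k = [set: 'rV[R]_N];
  strat_disjoint : trivIset [set: 'I_N.+1] M;
  strat_flat : forall k x, M k x -> exists r V, flat_at M k x r V;
  strat_frontier : forall k l : 'I_N.+1, (k < l)%N ->
    M k `&` closure (M l) !=set0 -> M k `<=` closure (M l);
  strat_closure : forall k,
    closure (M k) `<=` \bigcup_(l in [set l : 'I_N.+1 | (l <= k)%N]) M l }.

(* For x in M k there is exactly one V with [flat_at M k x r V] for some r. *)
Definition tangent_space M k x : {vspace 'rV[R]_N} :=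
  xget 0%VS [set V | exists r, flat_at M k x r V].

Definition dimc {J : 'I_N.+1 -> nat} (p : comp_index J) : 'I_N.+1 := tag p.

Record connected_components_of M (J : 'I_N.+1 -> nat)
    (Mc : comp_index J -> set 'rV[R]_N) : Prop := {
  comp_component : forall p, exists2 x, M (dimc p) x &
    Mc p = connected_component (M (dimc p)) x;
  comp_cover : forall k x, M k x -> exists j : 'I_(J k), Mc (existT _ k j) x;
  comp_inj : injective Mc }.

Definition L_set {J : 'I_N.+1 -> nat} (Mc : comp_index J -> set 'rV[R]_N) x :
    set (comp_index J) := [set p | closure (Mc p) x].

End Stratification.

Section ControlData.
Context {R : realType} {N : nat} {J : 'I_N.+1 -> nat}.
Variables (M : 'I_N.+1 -> set 'rV[R]_N) (Mc : comp_index J -> set 'rV[R]_N).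
Variables (A : comp_index J -> topologicalType).
Variables (b : forall p, 'rV[R]_N -> A p -> 'rV[R]_N).
Variables (ell : forall p, 'rV[R]_N -> A p -> R).
Implicit Types (p : comp_index J) (x y : 'rV[R]_N).

Definition bl_set p x : set ('rV[R]_N * R^o)%type :=
  [set (b x a, ell x a : R^o) | a in [set: A p]].

Definition BL_hull (k : 'I_N.+1) y : set ('rV[R]_N * R^o)%type :=
  closed_convex_hull
    (\bigcup_(p in [set p | L_set Mc y p /\ (k < dimc p)%N]) bl_set p y).

Definition B_hull (k : 'I_N.+1) y : set 'rV[R]_N :=
  [set v | exists l : R, BL_hull k y (v, l)].

Definition normal_controllability : Prop :=
  exists2 delta : R, 0 < delta &
    forall (k : 'I_N.+1) x, (k < N)%N -> M k x ->
    exists r V, flat_at M k x r V /\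
      forall y, eball x r y -> ~ M k y ->
        eball 0 delta `&` orthogonal_complement V `<=`
        B_hull k y `&` orthogonal_complement V.

Record standing_assumptions (c : comp_index J -> R) (cbar : R) : Prop := {
  control_nonempty : forall p, [set: A p] !=set0;
  dynamics_tangent : forall p x (a : A p), Mc p x ->
    b x a \in tangent_space M (dimc p) x;
  data_bounded : forall p, exists C : R, forall x (a : A p),
    enorm (b x a) <= C /\ `|ell x a| <= C;
  dynamics_continuous : forall p,
    continuous (fun z : 'rV[R]_N * A p => b z.1 z.2);
  cost_continuous : forall p,
    continuous (fun z : 'rV[R]_N * A p => ell z.1 z.2);
  bl_convex : forall p x,
    convex_set (bl_set p x : set (convex_lmodType ('rV[R]_N * R^o)%type));
  bl_compact : forall p x, compact (bl_set p x);
  dynamics_lipschitz : forall p (r : R), 0 < r -> exists C : R,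
    forall x y (a : A p), eball 0 r x -> eball 0 r y ->
      enorm (b x a - b y a) <= C * enorm (x - y);
  cbar_gt0 : 0 < cbar;
  discount_ge : forall p, cbar <= c p;
  controllability : normal_controllability }.

End ControlData.

Section Triangulation.
Context {R : realType} {N : nat}.
Implicit Types (P : 'I_N.+1 -> 'rV[R]_N) (I : {set 'I_N.+1}).

(* Convex hull of the points P i, i \in I. *)
Definition face P I : set 'rV[R]_N :=
  [set x | exists t : 'I_N.+1 -> R,
    [/\ forall i, 0 <= t i, forall i, i \notin I -> t i = 0,
        \sum_i t i = 1 & x = \sum_i t i *: P i]].

Definition simplex P : set 'rV[R]_N := face P [set: 'I_N.+1]%SET.

Definition affinely_independent P : Prop :=
  forall t : 'I_N.+1 -> R,
    \sum_i t i = 0 -> \sum_i t i *: P i = 0 -> forall i, t i = 0.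

(* T tau i is the i-th vertex of S_tau. *)
Implicit Types (T : nat -> 'I_N.+1 -> 'rV[R]_N) (X : nat -> 'rV[R]_N).
Implicit Types (beta : nat -> 'rV[R]_N -> R) (w : 'rV[R]_N -> R).

Record triangulation T : Prop := {
  tri_simplex : forall tau, affinely_independent (T tau);
  tri_cover : \bigcup_tau simplex (T tau) = [set: 'rV[R]_N];
  (* two simplices meet along a common, possibly empty, face *)
  tri_face_to_face : forall tau tau', exists I I',
    simplex (T tau) `&` simplex (T tau') = face (T tau) I /\
    simplex (T tau) `&` simplex (T tau') = face (T tau') I' }.

Definition greatest_ball (S : set 'rV[R]_N) (x : 'rV[R]_N) (r : R) : Prop :=
  [/\ 0 < r, eball x r `<=` S & forall y s, eball y s `<=` S -> s <= r].

Definition nondegenerate_triangulation T (dx : R) : Prop :=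
  exists rho : R, [/\ 0 < rho, rho < 1,
    forall tau, diam (simplex (T tau)) <= dx &
    forall tau, exists x r, greatest_ball (simplex (T tau)) x r /\
      rho * dx <= diam (eball x r)].

Definition vertex_enumeration T X : Prop :=
  injective X /\ range X = [set x | exists tau i, x = T tau i].

(* W^{dx}; the gradient is taken in the interior of each simplex. *)
Definition W_space T : set ('rV[R]_N -> R) :=
  [set w | continuous (w : 'rV[R]_N -> R^o) /\
    forall tau, exists g : 'rV[R]_N, forall x, interior (simplex (T tau)) x ->
      differentiable (w : 'rV[R]_N -> R^o) x /\
      forall v, 'd (w : 'rV[R]_N -> R^o) x v = dotp g v].

(* The relations 0 <= beta <= 1, \sum beta = 1, at most N+1 nonzero values at
   a point, and w = \sum beta w(x_sigma) on W are consequences. *)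
Definition basis_functions T X beta : Prop :=
  (forall sigma, W_space T (beta sigma)) /\
  (forall sigma tau, beta sigma (X tau) = (sigma == tau)%:R).

Record adapted_to_stratification (M : 'I_N.+1 -> set 'rV[R]_N) T X beta : Prop := {
  adapted_basis : forall k x sigma, M k x -> beta sigma x != 0 ->
    closure (M k) (X sigma);
  (* closure (M k) is the union of the k-dimensional faces it contains *)
  adapted_induced : forall k x, closure (M k) x -> exists tau I,
    [/\ #|I| = k.+1, face (T tau) I x & face (T tau) I `<=` closure (M k)];
  adapted_vertices : M ord0 `<=` range X }.

End Triangulation.

Section Scheme.
Context {R : realType} {N : nat} {J : 'I_N.+1 -> nat}.
Variables (Mc : comp_index J -> set 'rV[R]_N).
Variables (A : comp_index J -> topologicalType).
Variables (b : forall p, 'rV[R]_N -> A p -> 'rV[R]_N).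
Variables (c : comp_index J -> R).
Variables (ell : forall p, 'rV[R]_N -> A p -> R).
Variables (X : nat -> 'rV[R]_N) (beta : nat -> 'rV[R]_N -> R) (h : R).

(* The sum over [set: nat] is the library's finitely supported sum: only
   finitely many beta tau are nonzero at a given point. *)
Definition scheme_cost (u : 'rV[R]_N -> R) p (x : 'rV[R]_N) (a : A p) : R :=
  (1 - c p * h) *
    (\sum_(tau \in [set: nat]) (beta tau (x + h *: b x a) * u (X tau))) +
  h * ell x a.

Definition scheme_equation (u : 'rV[R]_N -> R) : Prop :=
  forall sigma : nat,
    (u (X sigma))%:E =
    \big[Order.min/+oo%E]_(p : comp_index J | p \in L_set Mc (X sigma))
      ereal_inf [set (scheme_cost u (X sigma) a)%:E | a in [set: A p]].

End Scheme.

Definition bounded_function {R : realType} {N : nat} (u : 'rV[R]_N -> R) : Prop :=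
  exists C : R, forall x, `|u x| <= C.

(* Main.v *)
Require Import Defs.
From mathcomp Require Import all_boot all_order all_algebra.
From mathcomp Require Import all_classical all_reals all_analysis.
From mathcomp Require Import lra ring.
Import Order.TTheory GRing.Theory Num.Theory.
Import numFieldNormedType.Exports.

(** A member of the finite element space W is affine on each simplex: its
    gradient is constant in the interior, and the mean value theorem on the
    segment from the barycenter carries the affine formula up to the boundary
    ([affine_on_simplex]). Consequently the basis functions restrict on a simplex
    to the barycentric coordinates of its vertices and to 0 for the other
    vertices. They are therefore nonnegative with sum 1, and w in W is the
    interpolant of its vertex values ([interp_vertices]). The scheme thus only
    involves the sequence of vertex values U, and reads U = Phi(U), where Phi(U)
    is at each vertex an infimum over the available strata and controls.

    Interpolation is an average, so it does not increase the uniform distance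
    ([interp_nonexpansive]); the cost of each control multiplies it by at most
    |1 - c h|, which is less than 1 because 0 < c h < 2, and infima do not
    increase it ([dp_operator_contracting]). There are finitely many discount
    factors, so Phi is a uniform contraction on bounded sequences, and it has
    exactly one bounded fixed point U.

    It remains to see that the interpolant of U lies in W ([interp_W]). It is
    affine on each simplex, and continuous provided that the vertices are locally
    finite ([vertices_locally_finite]). This is where nondegeneracy is used:
    every simplex contains a ball of a fixed radius, simplices whose inscribed
    balls have close centers overlap, and two overlapping simplices coincide
    because their common face has nonempty interior. A packing argument in a
    compact cube concludes. *)

Local Open Scope classical_set_scope.
Local Open Scope ring_scope.

Set Implicit Arguments.
Unset Strict Implicit.
Unset Printing Implicit Defensive.

(** * Finite sums and comparison of norms *)

Section EuclideanVersusSup.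
Context {R : realType} {N : nat}.
Implicit Types v x : 'rV[R]_N.

Lemma rV_norm_le v (K : R) : 0 <= K -> (forall i, `|v 0 i| <= K) -> `|v| <= K.
Proof.
move=> K0 vK; rewrite -[`|v|]/(mx_norm v) mx_normrE.
by apply: bigmax_le => // -[i j] _; rewrite ord1.
Qed.

Lemma norm_coord_le v i : `|v 0 i| <= `|v|.
Proof.
rewrite -[`|v|]/(mx_norm v) mx_normrE.
exact: (le_bigmax 0 (fun ij : 'I_1 * 'I_N => `|v ij.1 ij.2|) (0, i)).
Qed.

Lemma norm_le_enorm v : `|v| <= enorm v.
Proof.
apply: rV_norm_le => [|i]; first exact: sqrtr_ge0.
rewrite -sqrtr_sqr ler_wsqrtr// /dotp (bigD1 i)//= -expr2 lerDl.
by apply: sumr_ge0 => j _; rewrite -expr2 sqr_ge0.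
Qed.

Lemma enorm_le_norm v : enorm v <= N.+1%:R * `|v|.
Proof.
have nv0 : 0 <= N.+1%:R * `|v| by rewrite mulr_ge0.
rewrite -(ger0_norm nv0) -sqrtr_sqr ler_wsqrtr// exprMn.
apply: (@le_trans _ _ (\sum_(i < N) `|v| ^+ 2)).
  apply: ler_sum => i _; rewrite -expr2 -real_normK ?num_real//.
  by rewrite ler_sqr ?nnegrE// norm_coord_le.
rewrite sumr_const card_ord -[_ *+ N]mulr_natl ler_wpM2r ?sqr_ge0//.
by rewrite -natrX ler_nat expnS expn1 (leq_trans (leqnSn N))// leq_pmulr.
Qed.

End EuclideanVersusSup.

Lemma continuous_sum {R : realType} {T : topologicalType} {I : Type} (r : seq I)
    (f : I -> T -> R^o) (x : T) :
  (forall i, {for x, continuous (f i)}) ->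
  {for x, continuous (fun y => \sum_(i <- r) f i y)}.
Proof.
move=> cf; elim: r => [|i r IH].
  have -> : (fun y => \sum_(i <- [::]) f i y) = cst 0.
    by apply/funext => y; rewrite big_nil.
  exact: cst_continuous.
have -> : (fun y => \sum_(j <- i :: r) f j y) =
    f i + (fun y => \sum_(j <- r) f j y).
  by apply/funext => y; rewrite big_cons.
exact: continuousD.
Qed.

(** * Barycentric coordinates *)

Section Barycentric.
Context {R : realType} {N : nat}.
Implicit Types (P : 'I_N.+1 -> 'rV[R]_N) (x y z : 'rV[R]_N).

(** Appending a constant coordinate 1 turns affine combinations of the vertices
    into linear ones, so that the coordinates solve a linear system. *)
Definition homogeneous x : 'rV[R]_(1 + N) := row_mx (const_mx 1) x.

Definition vertex_mx P : 'M[R]_(1 + N) :=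
  row_mx (const_mx 1 : 'cV[R]_N.+1) (\matrix_(i < N.+1) P i).

Definition bary P x (i : 'I_N.+1) : R :=
  (homogeneous x *m invmx (vertex_mx P)) 0 i.

Lemma mul_vertex_mx P (t : 'rV[R]_N.+1) :
  t *m vertex_mx P =
  row_mx (const_mx (\sum_i t 0 i)) (\sum_i t 0 i *: P i) :> 'rV[R]_(1 + N).
Proof.
rewrite mul_mx_row; congr row_mx.
  by apply/rowP => j; rewrite !mxE; apply: eq_bigr => i _; rewrite !mxE mulr1.
by rewrite mulmx_sum_row; apply: eq_bigr => i _; rewrite rowK.
Qed.

Lemma vertex_mx_unit P : affinely_independent P -> vertex_mx P \in unitmx.
Proof.
move=> Pfree; rewrite -row_free_unit; apply: inj_row_free => t.
rewrite mul_vertex_mx -[RHS]row_mx0 => /eq_row_mx[/rowP/(_ 0) t1 tP].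
rewrite !mxE in t1.
by apply/rowP => i; rewrite mxE; exact: (Pfree (t 0) t1 tP).
Qed.

Section AffinelyIndependentVertices.
Variables (P : 'I_N.+1 -> 'rV[R]_N) (Pfree : affinely_independent P).

Lemma bary_sum x : \sum_i bary P x i = 1 /\ \sum_i bary P x i *: P i = x.
Proof.
have := mulmxKV (vertex_mx_unit Pfree) (homogeneous x).
rewrite mul_vertex_mx => /eq_row_mx[/rowP/(_ 0)].
by rewrite !mxE.
Qed.

Lemma bary_unique x (t : 'I_N.+1 -> R) :
  \sum_i t i = 1 -> \sum_i t i *: P i = x -> bary P x =1 t.
Proof.
move=> t1 tP i; rewrite /bary /homogeneous.
suff -> : row_mx (const_mx 1) x = (\row_j t j) *m vertex_mx P.
  by rewrite mulmxK ?vertex_mx_unit// mxE.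
rewrite mul_vertex_mx; congr row_mx.
  by congr const_mx; rewrite -t1; apply: eq_bigr => j _; rewrite mxE.
by rewrite -tP; apply: eq_bigr => j _; rewrite mxE.
Qed.

Lemma bary_vertex i j : bary P (P i) j = (j == i)%:R.
Proof.
rewrite (bary_unique (t := fun j => (j == i)%:R))//.
  by rewrite (bigD1 i)//= eqxx big1 ?addr0// => k /negPf ->.
rewrite (bigD1 i)//= eqxx scale1r big1 ?addr0// => k /negPf ->.
by rewrite scale0r.
Qed.

Lemma vertex_inj : injective P.
Proof.
move=> i j Pij; have := bary_vertex i i; rewrite Pij bary_vertex eqxx.
by case: eqP => // _ /eqP; rewrite eq_sym oner_eq0.
Qed.

Lemma bary_segment x y (s : R) i :
  bary P (x + s *: (y - x)) i = bary P x i + s * (bary P y i - bary P x i).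
Proof.
have [x1 xP] := bary_sum x; have [y1 yP] := bary_sum y.
rewrite (bary_unique (t := fun i => bary P x i + s * (bary P y i - bary P x i)))//.
  by rewrite big_split -mulr_sumr sumrB /= x1 y1 subrr mulr0 addr0.
under eq_bigr do rewrite scalerDl -scalerA scalerBl.
by rewrite big_split -scaler_sumr sumrB /= xP yP.
Qed.

Lemma bary_affine_comb (t : 'I_N.+1 -> R) (Q : 'I_N.+1 -> 'rV[R]_N) i :
  \sum_j t j = 1 ->
  bary P (\sum_j t j *: Q j) i = \sum_j t j * bary P (Q j) i.
Proof.
move=> t1; apply: (bary_unique (t := fun i => \sum_j t j * bary P (Q j) i)).
  rewrite exchange_big -[RHS]t1; apply: eq_bigr => j _.
  by rewrite -mulr_sumr (bary_sum (Q j)).1 mulr1.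
under eq_bigr do rewrite scaler_suml.
rewrite exchange_big; apply: eq_bigr => j _ /=.
under eq_bigr do rewrite -scalerA.
by rewrite -scaler_sumr (bary_sum (Q j)).2.
Qed.

Lemma bary_continuous i : continuous (bary P ^~ i : 'rV[R]_N -> R^o).
Proof.
set B := invmx (vertex_mx P).
have -> : (fun x => bary P x i : R^o) =
    (fun x : 'rV_N => B 0 i + \sum_(j < N) x 0 j * B (rshift 1 j) i).
  apply/funext => x; rewrite /bary mxE big_split_ord /= big_ord1.
  rewrite row_mxEl mxE mul1r; congr (_ + _); first by congr (B _ _); apply: val_inj.
  by apply: eq_bigr => j _; rewrite row_mxEr.
move=> x; apply: (@continuousD R R^o 'rV[R]_N (fun=> B 0 i)); first exact: cst_continuous.
apply: continuous_sum => j.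
apply: (@continuousM R 'rV[R]_N (fun x => x 0 j) (fun=> B (rshift 1 j) i)).
  exact: coord_continuous.
exact: cst_continuous.
Qed.

Lemma faceP (I : {set 'I_N.+1}) x :
  face P I x <->
  (forall i, 0 <= bary P x i) /\ (forall i, i \notin I -> bary P x i = 0).
Proof.
split=> [[t [t0 tI t1 ->]]|[x0 xI]].
  by split=> i *; rewrite (bary_unique t1 erefl)// tI.
by exists (bary P x); have [x1 xP] := bary_sum x; split.
Qed.

Lemma simplexP x : simplex P x <-> forall i, 0 <= bary P x i.
Proof.
rewrite /simplex faceP; split=> [[]//|x0]; split=> // i.
by rewrite inE.
Qed.

Lemma simplex_vertex i : simplex P (P i).
Proof. by apply/simplexP => j; rewrite bary_vertex ler0n. Qed.

Lemma bary_gt0_interior x :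
  (forall i, 0 < bary P x i) -> interior (simplex P) x.
Proof.
move=> x0; have : \forall y \near x, forall i, 0 < bary P y i.
  apply: (filter_forall (F := nbhs x)) => i; have := @bary_continuous i x.
  by move/cvgr_gt; exact.
by apply: filterS => y y0; apply/simplexP => i; rewrite ltW.
Qed.

Definition barycenter : 'rV[R]_N := \sum_i (N.+1%:R^-1 : R) *: P i.

Lemma bary_barycenter i : bary P barycenter i = N.+1%:R^-1.
Proof.
rewrite (bary_unique (t := fun=> N.+1%:R^-1))//.
by rewrite sumr_const card_ord -[_ *+ _]mulr_natl mulfV.
Qed.

(** Near a point of the interior one can move a little towards a vertex outside
    the face, which makes the corresponding coordinate nonzero. *)
Lemma face_interior (I : {set 'I_N.+1}) x :
  interior (face P I) x -> I = [set: 'I_N.+1]%SET.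
Proof.
move=> xI; apply/setP => i; rewrite inE; apply/negbNE/negP => iI.
have xi : bary P x i = 0.
  by have /faceP[_ ->] : face P I x := nbhs_singleton xI.
have path_cvg : x + s *: (P i - x) @[s --> (0 : R)] --> x.
  rewrite -[X in _ --> X]addr0 -(scale0r (P i - x)).
  by apply: cvgD; [exact: cvg_cst|apply: cvgZ; [exact: cvg_id|exact: cvg_cst]].
have /nbhs_ballP[e /= e0 eI] := path_cvg _ xI.
have /faceP[_ /(_ i iI)] : face P I (x + (e / 2) *: (P i - x)).
  apply: eI; rewrite -ball_normE /ball_/= sub0r normrN gtr0_norm ?divr_gt0//.
  by rewrite ltr_pdivrMr// ltr_pMr// ltr1n.
rewrite bary_segment xi bary_vertex eqxx subr0 add0r mulr1 => /eqP.
by rewrite gt_eqF ?divr_gt0.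
Qed.

End AffinelyIndependentVertices.
End Barycentric.

(** * Piecewise affine functions *)

Section PiecewiseAffine.
Context {R : realType} {N : nat}.
Implicit Types (P : 'I_N.+1 -> 'rV[R]_N) (x y z : 'rV[R]_N).
Implicit Types (w : 'rV[R]_N -> R) (T : nat -> 'I_N.+1 -> 'rV[R]_N).

Lemma dotpC x y : dotp x y = dotp y x.
Proof. by apply: eq_bigr => i _; rewrite mulrC. Qed.

Lemma dotpDr x y z : dotp x (y + z) = dotp x y + dotp x z.
Proof.
by rewrite -big_split; apply: eq_bigr => i _; rewrite !mxE mulrDr.
Qed.

Lemma dotpZr x (a : R) y : dotp x (a *: y) = a * dotp x y.
Proof.
by rewrite /dotp mulr_sumr; apply: eq_bigr => i _; rewrite !mxE mulrCA.
Qed.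

Lemma dotp_sumr x (I : Type) (r : seq I) (y : I -> 'rV[R]_N) :
  dotp x (\sum_(i <- r) y i) = \sum_(i <- r) dotp x (y i).
Proof.
elim: r => [|i r IH]; last by rewrite !big_cons dotpDr IH.
by rewrite !big_nil /dotp big1// => i _; rewrite mxE mulr0.
Qed.

Definition has_gradient w g x : Prop :=
  differentiable (w : 'rV[R]_N -> R^o) x /\
  forall v, 'd (w : 'rV[R]_N -> R^o) x v = dotp g v.

Lemma has_gradient_derive_along w g z v (s : R) :
  has_gradient w g (z + s *: v) ->
  is_derive s 1 (fun t : R => w (z + t *: v) : R^o) (dotp g v).
Proof.
move=> [dw wg].
(* The difference quotients of w along v and of its restriction to the line
   are the same function. *)
have quotE : (fun h : R => h^-1 *: (((fun t : R => w (z + t *: v) : R^o) \o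
      shift s) (h *: 1) - w (z + s *: v))) =
    (fun h : R => h^-1 *: (((w : 'rV_N -> R^o) \o shift (z + s *: v)) (h *: v)
      - w (z + s *: v))).
  apply/funext => h /=; congr (_ *: (w _ - _)).
  by rewrite [h%:A]mulr1 scalerDl addrCA addrA addrC addrA addrC.
have dv : derivable (w : 'rV_N -> R^o) (z + s *: v) v by exact: diff_derivable.
apply: DeriveDef; first by rewrite /derivable quotE.
by rewrite /derive quotE -[LHS]/('D_v (w : 'rV_N -> R^o) (z + s *: v)) deriveE.
Qed.

(** Every point of a simplex is joined to the barycenter by a segment that is
    interior to the simplex except possibly at that point, so the mean value
    theorem on that segment sees only the constant gradient. *)
Lemma affine_on_simplex P w g x : affinely_independent P ->
  continuous (w : 'rV[R]_N -> R^o) ->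
  (forall y, interior (simplex P) y -> has_gradient w g y) ->
  simplex P x -> w x = w (barycenter P) + dotp g (x - barycenter P).
Proof.
move=> Pfree cw gw /(simplexP Pfree) x0.
set z := barycenter P.
pose f (s : R) : R^o := w (z + s *: (x - z)).
have cf : continuous f.
  move=> s; apply: (@continuous_comp _ _ _ (fun s : R => z + s *: (x - z)) w).
    apply: cvgD; first exact: cvg_cst.
    by apply: cvgZ; [exact: cvg_id|exact: cvg_cst].
  exact: cw.
have df (s : R) : s \in `]0, 1[ -> is_derive s 1 f (dotp g (x - z)).
  rewrite in_itv/= => /andP[s0 s1].
  apply: has_gradient_derive_along; apply: gw.
  apply: bary_gt0_interior => // i.
  rewrite bary_segment// bary_barycenter//.
  rewrite (_ : _ + _ = (1 - s) * N.+1%:R^-1 + s * bary P x i); last by ring.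
  by rewrite ltr_pwDl// ?mulr_ge0 ?mulr_gt0 ?subr_gt0 ?invr_gt0// ltW.
have [|s _] := MVT (ltr01 : 0 < 1 :> R) df.
  by apply: continuous_subspaceT => s; exact: cf.
rewrite /f scale1r scale0r addr0 subr0 mulr1 (addrC z) subrK => /eqP.
by rewrite subr_eq addrC => /eqP.
Qed.

Lemma W_space_bary T w tau x : affinely_independent (T tau) ->
  W_space T w -> simplex (T tau) x ->
  w x = \sum_i bary (T tau) x i * w (T tau i).
Proof.
move=> Tfree [cw /(_ tau)[g wg]] Sx.
have wE y : simplex (T tau) y ->
  w y = w (barycenter (T tau)) + dotp g (y - barycenter (T tau)).
  exact: affine_on_simplex.
set z := barycenter (T tau) in wE *.
have [x1 xP] := bary_sum Tfree x.
have -> : \sum_i bary (T tau) x i * w (T tau i) =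
    \sum_i bary (T tau) x i * w z +
    \sum_i dotp g (bary (T tau) x i *: (T tau i - z)).
  rewrite -big_split; apply: eq_bigr => i _ /=.
  by rewrite (wE (T tau i)) ?mulrDr ?dotpZr//; exact: simplex_vertex.
rewrite -mulr_suml x1 mul1r -dotp_sumr wE//; congr (_ + dotp g _).
under eq_bigr do rewrite scalerBr.
by rewrite sumrB xP -scaler_suml x1 scale1r.
Qed.

Lemma has_gradient_near w w' g x :
  {near x, w =1 w'} -> has_gradient w g x -> has_gradient w' g x.
Proof.
move=> ww' [dw wg].
have [cdw /eqaddoP wE] := (diff_locallyP x (w : 'rV_N -> R^o)).1 dw.
have shift_cvg : (id \o shift x) @ (0 : 'rV[R]_N) --> x.
  by rewrite cvg_comp_shift add0r; exact: cvg_id.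
have w'E : (w' : 'rV_N -> R^o) \o shift x =
    cst (w' x : R^o) + 'd (w : 'rV_N -> R^o) x +o_ (0 : 'rV[R]_N) id.
  apply/eqaddoP => e e0; near=> y.
  rewrite !fctE /= -(nbhs_singleton ww').
  suff <- : w (y + x) = w' (y + x) by near: y; exact: wE.
  by near: y; exact: shift_cvg ww'.
have diffE := diff_unique cdw w'E.
by split=> [|v]; [apply/diff_locallyP; rewrite diffE|rewrite diffE].
Unshelve. all: by end_near. Qed.

Lemma has_gradient_lincomb (n : nat) (a : 'I_n -> R) (w : 'I_n -> 'rV[R]_N -> R)
    (g : 'I_n -> 'rV[R]_N) x :
  (forall i, has_gradient (w i) (g i) x) ->
  has_gradient (fun y => \sum_i a i * w i y) (\sum_i a i *: g i) x.
Proof.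
move=> wg.
elim: n a w g wg => [|n IH] a w g wg.
  have -> : (fun y => \sum_(i < 0) a i * w i y) = cst 0.
    by apply/funext => y; rewrite big_ord0.
  split=> [|v]; first exact: differentiable_cst.
  by rewrite big_ord0 diff_cst /dotp big1// => i _; rewrite mxE mul0r.
have [dS Sg] := IH (a \o lift ord0) (w \o lift ord0) (g \o lift ord0)
  (fun i => wg (lift ord0 i)).
have [dw0 wg0] := wg ord0.
have dZ : differentiable (a ord0 *: (w ord0 : 'rV_N -> R^o)) x.
  exact: differentiableZ.
have -> : (fun y => \sum_i a i * w i y) = (a ord0 *: (w ord0 : 'rV_N -> R^o)) +
    (fun y => \sum_i (a \o lift ord0) i * (w \o lift ord0) i y : R^o).
  by apply/funext => y; rewrite big_ord_recl.
split=> [|v]; first exact: differentiableD.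
rewrite diffD//= diffZ//= wg0 Sg big_ord_recl.
by rewrite (dotpC (_ + _)) dotpDr dotpZr !(dotpC v).
Qed.

End PiecewiseAffine.

(** * Local finiteness of the triangulation *)

Section LocalFiniteness.
Context {R : realType} {N : nat}.
Implicit Types (P Q : 'I_N.+1 -> 'rV[R]_N) (x y z : 'rV[R]_N).
Implicit Types (T : nat -> 'I_N.+1 -> 'rV[R]_N) (X : nat -> 'rV[R]_N).

Lemma simplex_norm_le P x : simplex P x -> `|x| <= \sum_i `|P i|.
Proof.
move=> [t [t0 _ t1 ->]]; apply: (le_trans (ler_norm_sum _ _ _)).
apply: ler_sum => i _; rewrite normrZ ger0_norm// ler_piMl//.
by rewrite -t1 (bigD1 i)//= lerDl sumr_ge0.
Qed.

Lemma simplex_diam_norm P x y : simplex P x -> simplex P y ->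
  `|x - y| <= diam (simplex P).
Proof.
move=> Px Py; apply: (le_trans (norm_le_enorm _)).
apply: ub_le_sup; last by exists x => //; exists y.
exists (N.+1%:R * (\sum_i `|P i| + \sum_i `|P i|)) => _ [a Pa [b Pb <-]].
rewrite (le_trans (enorm_le_norm _))// ler_wpM2l//.
by rewrite (le_trans (ler_normB _ _))// lerD// simplex_norm_le.
Qed.

(** Nondegeneracy bounds the Euclidean inradius of all simplices from below,
    which gives a common radius for the balls of the sup norm as well. *)
Lemma inscribed_ball T (dx : R) : 0 < dx -> nondegenerate_triangulation T dx ->
  exists2 delta : R, 0 < delta &
    forall tau, exists y, ball y delta `<=` simplex (T tau).
Proof.
move=> dx0 [rho [rho0 _ _ Tball]].
have n0 : 0 < N.+1%:R :> R by [].
(* One factor N + 1 comes from bounding the Euclidean diameter of a ball by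
   its radius, the other from comparing the two norms. *)
exists (rho * dx / (2 * N.+1%:R * N.+1%:R)).
  by rewrite divr_gt0 ?mulr_gt0.
move=> tau; have [x [r [[r0 xrS _] rdiam]]] := Tball tau.
exists x => z xz; apply: xrS.
have rge : rho * dx <= 2 * N.+1%:R * r.
  apply: (le_trans rdiam); apply: ge_sup.
    have xx : eball x r x.
      by rewrite /eball/= (le_lt_trans (enorm_le_norm _))// subrr normr0 mulr0.
    by exists (enorm (x - x)), x => //; exists x.
  move=> _ [a ra [b rb <-]]; rewrite (le_trans (enorm_le_norm _))//.
  rewrite -mulrA mulrCA ler_wpM2l// mulr_natl mulr2n -(subrKA x).
  rewrite (le_trans (ler_normD _ _))// lerD//.
    by rewrite ltW// (le_lt_trans (norm_le_enorm _)).
  by rewrite distrC ltW// (le_lt_trans (norm_le_enorm _)).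
apply: (le_lt_trans (enorm_le_norm _)).
move: xz; rewrite -ball_normE /ball_/= distrC => xz.
rewrite mulrC -ltr_pdivlMr//; apply: (lt_le_trans xz).
rewrite ler_pdivrMr ?mulr_gt0//.
rewrite (_ : r / N.+1%:R * _ = 2 * N.+1%:R * r)//.
by move: (N.+1%:R : R) n0 => n n0; field; rewrite gt_eqF.
Qed.

(** Vertices are extreme points: writing [P i] as a convex combination of the
    [Q j], each lying in [simplex P], its i-th coordinate is 1 only if some
    [Q j] of positive weight has i-th coordinate 1. *)
Lemma simplex_vertex_sub P Q : affinely_independent P ->
  simplex P = simplex Q -> affinely_independent Q ->
  range P `<=` range Q.
Proof.
move=> Pfree PQ Qfree _ [i _ <-].
have [t [t0 _ t1 tP]] : simplex Q (P i) by rewrite -PQ; exact: simplex_vertex.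
apply: contrapT => Pi.
have Qi j : bary P (Q j) i < 1.
  have /(simplexP Pfree) Qj0 : simplex P (Q j) by rewrite PQ; exact: simplex_vertex.
  have [Qj1 QjP] := bary_sum Pfree (Q j).
  rewrite lt_neqAle; apply/andP; split; last first.
    by rewrite -Qj1 (bigD1 i)//= lerDl sumr_ge0.
  apply/eqP => Qji; apply: Pi; exists j => //.
  have rest0 k : k != i -> bary P (Q j) k = 0.
    move: Qj1; rewrite (bigD1 i)//= Qji -[RHS]addr0 => /addrI.
    by move/psumr_eq0P => rest ki; apply: rest.
  rewrite -QjP (bigD1 i)//= Qji scale1r big1 ?addr0// => k ki.
  by rewrite rest0// scale0r.
have := bary_affine_comb Pfree Q i t1; rewrite -tP bary_vertex// eqxx => tQ.
have : \sum_j t j * (1 - bary P (Q j) i) = 0.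
  by under eq_bigr do rewrite mulrBr mulr1; rewrite sumrB t1 -tQ subrr.
move/psumr_eq0P => t_eq0.
have : \sum_j t j = 0.
  apply: big1 => j _; have /eqP : t j * (1 - bary P (Q j) i) = 0.
    by apply: t_eq0 => // k _; rewrite mulr_ge0// subr_ge0 ltW.
  by rewrite mulf_eq0 subr_eq0 (gt_eqF (Qi j)) orbF => /eqP.
by rewrite t1 => /eqP; rewrite oner_eq0.
Qed.

(** Two simplices meeting in a set with nonempty interior coincide, because
    the common face has then full dimension; so do their sets of vertices. *)
Lemma overlapping_simplices T tau tau' y : triangulation T ->
  interior (simplex (T tau)) y -> interior (simplex (T tau')) y ->
  range (T tau) `<=` range (T tau').
Proof.
move=> Ttri yS yS'.
have Tfree k : affinely_independent (T k) by exact: tri_simplex.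
have yI : interior (simplex (T tau) `&` simplex (T tau')) y by exact: filterI.
have [I [I' [SI SI']]] := tri_face_to_face Ttri tau tau'.
have SE : simplex (T tau) = simplex (T tau').
  move: (yI); rewrite SI => /(face_interior (Tfree tau)) IT.
  move: (yI); rewrite SI' => /(face_interior (Tfree tau')) I'T.
  by rewrite /simplex -{1}IT -I'T -SI -SI'.
exact: simplex_vertex_sub.
Qed.

(** Inscribed balls of a fixed radius delta force simplices whose inscribed
    centers are less than delta apart to share their vertices; compactness of
    cubes then leaves finitely many vertices in a bounded region. *)
Lemma vertices_locally_finite T X (dx : R) (B : R) : 0 < dx ->
  triangulation T -> nondegenerate_triangulation T dx ->
  vertex_enumeration T X -> finite_set [set sigma | `|X sigma| <= B].
Proof.
move=> dx0 Ttri Tnd [Xinj rX].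
have Tfree k : affinely_independent (T k) by exact: tri_simplex.
have [delta d0 /choice[ctr ctrP]] := inscribed_ball dx0 Tnd.
have [rho [_ _ Tdx _]] := Tnd.
have ctr_in tau : interior (simplex (T tau)) (ctr tau).
  by apply/nbhs_ballP; exists delta.
pose near_z (z : 'rV[R]_N) :=
  [set sigma | exists tau i, X sigma = T tau i /\ ball z (delta / 2) (ctr tau)].
have near_z_fin z : finite_set (near_z z).
  have [[tau0 ztau0]|no_tau] :=
      pselect (exists tau0, ball z (delta / 2) (ctr tau0)); last first.
    rewrite (_ : near_z z = set0)//; apply/seteqP; split=> // s [tau [i [_ ?]]].
    by apply: no_tau; exists tau.
  apply: (@sub_finite_set _ _ (X @^-1` range (T tau0))); last first.
    by apply: finite_preimage; [move=> ? ? _ _; exact: Xinj|exact: finite_image finite_finset].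
  move=> s [tau [i [Xs ztau]]] /=; rewrite Xs.
  apply: (@overlapping_simplices T tau tau0 (ctr tau)) => //.
  apply: filterS (ctrP tau0) _; apply: open_nbhs_nbhs; split.
    exact: ball_open.
  by rewrite [delta]splitr; apply: ball_triangle ztau; exact: ball_sym.
(* A simplex with a vertex of norm at most B has its center in this cube. *)
pose cube := [set v : 'rV[R]_N | forall i, `[- (B + dx), B + dx]%classic (v 0 i)].
have : compact cube.
  exact: (rV_compact (fun i => @segment_compact R (- (B + dx)) (B + dx))).
rewrite compact_cover => /(_ _ cube (fun z => ball z (delta / 2))).
case=> [z _|z zc|D _ cubeD].
- exact: ball_open.
- by exists z => //; apply: ballxx; rewrite divr_gt0.
apply: sub_finite_set (bigcup_finite (finite_fset D) (fun z _ => near_z_fin z)).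
move=> s /= Xs.
have [tau [i XsE]] : [set x | exists tau i, x = T tau i] (X s).
  by rewrite -rX; exists s.
have [|z Dz zball] := cubeD (ctr tau).
  move=> i' /=; rewrite in_itv/= -ler_norml (le_trans (norm_coord_le _ _))//.
  rewrite -(subrK (X s) (ctr tau)) addrC (le_trans (ler_normD _ _))// lerD//.
  rewrite XsE (le_trans _ (Tdx tau))// simplex_diam_norm//.
    exact: nbhs_singleton (ctr_in tau).
  exact: simplex_vertex.
by exists z => //; exists tau, i.
Qed.

End LocalFiniteness.

(** * Interpolation by the basis functions *)

Section Interpolation.
Context {R : realType} {N : nat}.
Variables (T : nat -> 'I_N.+1 -> 'rV[R]_N) (X : nat -> 'rV[R]_N).
Variable (beta : nat -> 'rV[R]_N -> R).
Hypothesis Ttri : triangulation T.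
Hypothesis Xenum : vertex_enumeration T X.
Hypothesis betaB : basis_functions T X beta.

Definition interp (U : nat -> R) (x : 'rV[R]_N) : R :=
  \sum_(s \in [set: nat]) beta s x * U s.

Let Tfree tau : affinely_independent (T tau).
Proof. exact: tri_simplex. Qed.

Lemma vertex_index tau : exists v : 'I_N.+1 -> nat,
  injective v /\ forall i, X (v i) = T tau i.
Proof.
have [_ rX] := Xenum.
have /choice[v vE] : forall i, exists s, X s = T tau i.
  move=> i; have [s _ <-] : range X (T tau i) by rewrite rX; exists tau, i.
  by exists s.
exists v; split=> // i j vij; apply: (vertex_inj (@Tfree tau)).
by rewrite -!vE vij.
Qed.

Section InOneSimplex.
Variables (tau : nat) (v : 'I_N.+1 -> nat).
Hypothesis (vinj : injective v) (vE : forall i, X (v i) = T tau i).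

Lemma basis_on_simplex s x : simplex (T tau) x ->
  beta s x = \sum_i bary (T tau) x i * (s == v i)%:R.
Proof.
move=> Sx; rewrite (W_space_bary (@Tfree tau) (betaB.1 s) Sx).
by apply: eq_bigr => i _; rewrite -vE betaB.2.
Qed.

Lemma basis_vertex i x : simplex (T tau) x -> beta (v i) x = bary (T tau) x i.
Proof.
move=> Sx; rewrite basis_on_simplex// (bigD1 i)//= eqxx mulr1 big1 ?addr0// => j.
by rewrite (inj_eq vinj) eq_sym => /negPf ->; rewrite mulr0.
Qed.

Lemma basis_other s x : (forall i, s != v i) -> simplex (T tau) x ->
  beta s x = 0.
Proof.
move=> sv Sx; rewrite basis_on_simplex// big1// => i _.
by rewrite (negPf (sv i)) mulr0.
Qed.

Lemma interp_on_simplex U x : simplex (T tau) x ->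
  interp U x = \sum_i U (v i) * beta (v i) x.
Proof.
move=> Sx; rewrite /interp (fsbigE (map v (enum 'I_N.+1))).
- rewrite big_map; under eq_bigl do rewrite in_setT.
  by rewrite big_enum; apply: eq_bigr => i _; rewrite mulrC.
- by rewrite map_inj_uniq// enum_uniq.
- by [].
move=> s _ sv; rewrite basis_other ?mul0r// => i.
by apply: contraNneq sv => ->; rewrite map_f// mem_enum.
Qed.

End InOneSimplex.

Lemma in_some_simplex x : exists tau, simplex (T tau) x.
Proof.
have [tau _ Sx] : (\bigcup_tau simplex (T tau)) x by rewrite tri_cover.
by exists tau.
Qed.

(** The basis functions are barycentric coordinates, hence nonnegative with
    sum 1: the interpolation operator is an average of vertex values, and so
    is nonexpansive in the uniform norm. *)
Lemma interp_nonexpansive U V (K : R) x :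
  (forall s, `|U s - V s| <= K) -> `|interp U x - interp V x| <= K.
Proof.
move=> UV; have [tau Sx] := in_some_simplex x.
have [v [vinj vE]] := vertex_index tau.
rewrite !(interp_on_simplex vinj vE)// -sumrB.
have [x1 _] := bary_sum (@Tfree tau) x.
rewrite (le_trans (ler_norm_sum _ _ _))// -[leRHS]mul1r -x1 mulr_suml.
apply: ler_sum => i _; rewrite -mulrBl normrM mulrC (basis_vertex vinj vE)//.
have /(simplexP (@Tfree tau))/(_ i) xi0 := Sx.
by rewrite ger0_norm// ler_wpM2l.
Qed.

Lemma interp0 x : interp (fun=> 0) x = 0.
Proof. by apply: fsbig1 => s _; rewrite mulr0. Qed.

Lemma interp_vertex U s : interp U (X s) = U s.
Proof.
rewrite /interp (fsbigE [:: s])//.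
  by rewrite big_cons big_nil in_setT betaB.2 eqxx /= mul1r addr0.
by move=> r _; rewrite inE betaB.2 => /negPf ->; rewrite mul0r.
Qed.

(** By local finiteness of the vertices the interpolant is, near each point, a
    finite sum of basis functions. *)
Lemma interp_continuous (dx : R) U : 0 < dx -> nondegenerate_triangulation T dx ->
  continuous (interp U : 'rV[R]_N -> R^o).
Proof.
move=> dx0 Tnd x.
have [rho [_ _ Tdx _]] := Tnd.
have /finite_seqP[r rE] :=
  vertices_locally_finite (`|x| + 1 + dx) dx0 Ttri Tnd Xenum.
have sumE : {near x, (fun y => \sum_(s <- undup r) beta s y * U s) =1 interp U}.
  apply/nbhs_ballP; exists 1 => //= y; rewrite -ball_normE /ball_/= => xy.
  rewrite /interp (fsbigE (undup r)) ?undup_uniq//.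
    by apply: eq_bigl => s; rewrite in_setT.
  move=> s _; apply: contraNeq => /eqP sy; rewrite mem_undup.
  suff : [set` r] s by [].
  rewrite -rE /=.
  have [tau Sy] := in_some_simplex y; have [v [vinj vE]] := vertex_index tau.
  have [i si] : exists i, s = v i.
    apply: contrapT => sv; apply: sy; rewrite (basis_other vE) ?mul0r// => i.
    by apply/eqP => si; apply: sv; exists i.
  rewrite si vE (_ : T tau i = x + (y - x) + (T tau i - y)); last first.
    by rewrite (addrC x) subrK addrC subrK.
  rewrite (le_trans (ler_normD _ _))// lerD//.
    by rewrite (le_trans (ler_normD _ _))// lerD// distrC ltW.
  by rewrite (le_trans _ (Tdx tau))// simplex_diam_norm//; exact: simplex_vertex.
apply: cvg_trans (near_eq_cvg sumE) _.
rewrite -(nbhs_singleton sumE).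
apply: (@continuous_sum R 'rV[R]_N nat (undup r) (fun s y => beta s y * U s)) => s.
apply: (@continuousM R 'rV[R]_N (beta s) (fun=> U s)); last exact: cst_continuous.
exact: (betaB.1 s).1.
Qed.

Lemma interp_W (dx : R) U : 0 < dx -> nondegenerate_triangulation T dx ->
  W_space T (interp U).
Proof.
move=> dx0 Tnd; split=> [|tau]; first exact: (@interp_continuous dx U dx0 Tnd).
have [v [vinj vE]] := vertex_index tau.
have /choice[g gP] : forall i, exists g, forall x,
    interior (simplex (T tau)) x -> has_gradient (beta (v i)) g x.
  by move=> i; have [_ /(_ tau)] := betaB.1 (v i).
exists (\sum_i U (v i) *: g i) => x Sx.
apply: (@has_gradient_near _ _ (fun y => \sum_i U (v i) * beta (v i) y)).
  by apply: filterS Sx => y Sy; rewrite (interp_on_simplex vinj vE).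
by apply: has_gradient_lincomb => i; exact: gP.
Qed.

(** Both sides are affine on each simplex with the same vertex values; hence a
    member of the finite element space is determined by its vertex values. *)
Lemma interp_vertices w : W_space T w -> interp (w \o X) = w.
Proof.
move=> Ww; apply/funext => x; have [tau Sx] := in_some_simplex x.
have [v [vinj vE]] := vertex_index tau.
rewrite (interp_on_simplex vinj vE)// (W_space_bary (@Tfree tau) Ww Sx).
by apply: eq_bigr => i _; rewrite (basis_vertex vinj vE)//= vE mulrC.
Qed.

End Interpolation.

(** * Uniform contractions on bounded families *)

Section UniformContraction.
Context {R : realType} {I : Type}.
Implicit Types U V : I -> R.

Definition bounded_family U := exists C, forall i, `|U i| <= C.

Lemma le_geometric_le0 (q D x : R) : 0 <= q -> q < 1 ->
  (forall n, x <= D * q ^+ n) -> x <= 0.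
Proof.
move=> q0 q1 xq.
have qD : geometric D q @ \oo --> 0 by apply: cvg_geometric; rewrite ger0_norm.
rewrite -(cvg_lim _ qD)//; apply: limr_ge; first by apply/cvg_ex; exists 0.
by apply: nearW => n; exact: xq.
Qed.

Variables (Phi : (I -> R) -> I -> R) (q : R).
Hypotheses (q_ge0 : 0 <= q) (q_lt1 : q < 1).
Hypothesis Phi0_bounded : bounded_family (Phi (fun=> 0)).
Hypothesis Phi_contracting : forall U V (K : R),
  bounded_family U -> bounded_family V ->
  (forall i, `|U i - V i| <= K) -> forall i, `|Phi U i - Phi V i| <= q * K.

(** The distance of two fixed points is multiplied by at most q at each
    application of Phi. *)
Lemma contraction_fixpoint_unique U V : bounded_family U -> bounded_family V ->
  Phi U =1 U -> Phi V =1 V -> U =1 V.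
Proof.
move=> bU bV fixU fixV i.
have [C UC] := bU; have [D VD] := bV.
suff UVn n : forall i, `|U i - V i| <= (C + D) * q ^+ n.
  apply/eqP; rewrite -subr_eq0 -normr_le0.
  exact: (le_geometric_le0 q_ge0 q_lt1 (fun n => UVn n i)).
elim: n => [|n IH] j.
  by rewrite mulr1 (le_trans (ler_normB _ _))// lerD.
rewrite -fixU -fixV exprS mulrCA.
exact: Phi_contracting.
Qed.

(** Picard iteration from 0. The iterates stay within D of 0, so that
    u_n and u_(n+k) differ by at most D q^n; the limit is then squeezed between
    u_n - D q^n and u_n + D q^n, and can be defined as a supremum. *)
Lemma contraction_fixpoint_exists : exists U, bounded_family U /\ Phi U =1 U.
Proof.
have [C PhiC] := Phi0_bounded.
have q1 : 0 < 1 - q by rewrite subr_gt0.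
(* D solves q D + max(C, 0) = D, so that Phi preserves the ball of radius D. *)
pose D := Num.max C 0 / (1 - q).
have D0 : 0 <= D by rewrite divr_ge0 ?(ltW q1)// le_max lexx orbT.
have DE : q * D + Num.max C 0 = D by rewrite /D; field; rewrite gt_eqF.
pose u n := iter n Phi (fun=> 0).
have uD n : forall i, `|u n i| <= D.
  elim: n => [|n IH] i; first by rewrite normr0.
  rewrite -DE -(subrK (Phi (fun=> 0) i) (u n.+1 i)).
  rewrite (le_trans (ler_normD _ _))// lerD//; last first.
    by rewrite (le_trans (PhiC i))// le_max lexx.
  apply: Phi_contracting; first by exists D.
    by exists 0 => j; rewrite normr0.
  by move=> j; rewrite subr0.
have ub n : bounded_family (u n) by exists D; exact: uD.
have uk n k : forall i, `|u (n + k)%N i - u n i| <= D * q ^+ n.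
  elim: n => [|n IH] i; first by rewrite subr0 mulr1 uD.
  by rewrite exprS mulrCA; exact: Phi_contracting.
have umn m n i : u m i - D * q ^+ m <= u n i + D * q ^+ n.
  have Dq0 k : 0 <= D * q ^+ k by rewrite mulr_ge0 ?exprn_ge0.
  have [mn|/ltnW nm] := leqP m n.
    have := uk m (n - m)%N i; rewrite subnKC// ler_norml => /andP[+ _].
    by move: (Dq0 n); lra.
  have := uk n (m - n)%N i; rewrite subnKC// ler_norml => /andP[_].
  by move: (Dq0 m); lra.
pose L i := [set u n i - D * q ^+ n | n in [set: nat]].
pose U i := sup (L i).
have Uu n i : `|U i - u n i| <= D * q ^+ n.
  rewrite ler_distl; apply/andP; split.
    apply: ub_le_sup; last by exists n.
    by exists (u 0%N i + D * q ^+ 0) => _ [m _ <-].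
  by apply: ge_sup; [exists (u 0%N i - D * q ^+ 0), 0%N|move=> _ [m _ <-]].
have bU : bounded_family U.
  by exists D => i; have := Uu 0%N i; rewrite subr0 mulr1.
exists U; split=> // i; apply/eqP; rewrite -subr_eq0 -normr_le0.
(* Phi U and U are both within q D q^n of the iterate of rank n + 1. *)
apply: (le_geometric_le0 q_ge0 q_lt1 (D := 2 * (q * D))) => n.
rewrite -(subrKA (u n.+1 i)) (le_trans (ler_normD _ _))//.
have := Phi_contracting bU (ub n) (Uu n) i.
have := Uu n.+1 i; rewrite distrC exprS /=; lra.
Qed.

End UniformContraction.

(** * The dynamic programming operator *)

Lemma inf_image_nonexpansive {R : realType} {I : Type} (D : set I)
    (f g : I -> R) (K : R) : D !=set0 ->
  has_lbound [set f i | i in D] -> has_lbound [set g i | i in D] ->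
  (forall i, D i -> `|f i - g i| <= K) ->
  `|inf [set f i | i in D] - inf [set g i | i in D]| <= K.
Proof.
move=> D0 fl gl fg.
have inf_le (f1 f2 : I -> R) : has_lbound [set f1 i | i in D] ->
    (forall i, D i -> `|f1 i - f2 i| <= K) ->
    inf [set f1 i | i in D] - K <= inf [set f2 i | i in D].
  move=> f1l f12; apply: lb_le_inf; first by have [i Di] := D0; exists (f2 i), i.
  move=> _ [i Di <-]; have /ler_normlP[_] := f12 i Di.
  have : inf [set f1 i | i in D] <= f1 i by apply: ge_inf => //; exists i.
  lra.
have fg' i : D i -> `|g i - f i| <= K by move=> Di; rewrite distrC fg.
have := inf_le f g fl fg; have := inf_le g f gl fg'.
by rewrite ler_norml => *; apply/andP; split; lra.
Qed.

Lemma bigmin_ereal_inf {R : realType} {I : finType} (P : pred I)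
    (S : I -> set (\bar R)) :
  \big[Order.min/+oo%E]_(i | P i) ereal_inf (S i) =
  ereal_inf (\bigcup_(i in [set i | P i]) S i).
Proof.
apply/le_anti/andP; split.
  apply: le_ereal_inf_tmp => x [i Pi Sx].
  by rewrite (le_trans (bigmin_le_cond _ _ Pi))// ereal_inf_lbound.
apply: le_bigmin => [|i Pi]; first exact: leey.
by apply: ereal_inf_le_tmp => x Sx; exists i.
Qed.

Section DynamicProgramming.
Context {R : realType} {N : nat} {J : 'I_N.+1 -> nat}.
Variables (Mc : comp_index J -> set 'rV[R]_N).
Variables (A : comp_index J -> topologicalType).
Variables (b : forall p, 'rV[R]_N -> A p -> 'rV[R]_N).
Variables (c : comp_index J -> R) (ell : forall p, 'rV[R]_N -> A p -> R).
Variables (T : nat -> 'I_N.+1 -> 'rV[R]_N) (X : nat -> 'rV[R]_N).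
Variables (beta : nat -> 'rV[R]_N -> R) (h q Cell : R).
Hypothesis Ttri : triangulation T.
Hypothesis Xenum : vertex_enumeration T X.
Hypothesis betaB : basis_functions T X beta.
Hypothesis h_gt0 : 0 < h.
Hypothesis discount_le : forall p, `|1 - c p * h| <= q.
Hypothesis ell_le : forall p x (a : A p), `|ell x a| <= Cell.
Hypothesis control_inhabited : forall p, [set: A p] !=set0.
Hypothesis L_inhabited : forall s, L_set Mc (X s) !=set0.

(** The pairs (stratum, control) available at a vertex are merged into a single
    index, which turns the minimum of infima into one infimum. *)
Definition available (s : nat) : set {p : comp_index J & A p} :=
  [set pa | L_set Mc (X s) (tag pa)].

Definition control_cost (U : nat -> R) (s : nat) (pa : {p : comp_index J & A p})
    : R :=
  (1 - c (tag pa) * h) * interp beta U (X s + h *: b (X s) (tagged pa)) +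
  h * ell (X s) (tagged pa).

Definition dp_operator (U : nat -> R) (s : nat) : R :=
  inf [set control_cost U s pa | pa in available s].

Lemma available_inhabited s : available s !=set0.
Proof.
have [p Lp] := L_inhabited s; have [a _] := control_inhabited p.
by exists (existT _ p a).
Qed.

Lemma control_cost_le U (C : R) s pa : (forall r, `|U r| <= C) ->
  `|control_cost U s pa| <= q * C + h * Cell.
Proof.
move=> UC; rewrite (le_trans (ler_normD _ _))// lerD//.
  rewrite normrM ler_pM//.
  rewrite -[interp _ _ _]subr0.
  rewrite -(interp0 beta (X s + h *: b (X s) (tagged pa))).
  by apply: (interp_nonexpansive Ttri Xenum betaB) => r; rewrite subr0.
by rewrite normrM (gtr0_norm h_gt0) ler_pM2l.
Qed.

Lemma control_cost_lbound U s : bounded_family U ->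
  has_lbound [set control_cost U s pa | pa in available s].
Proof.
move=> [C UC]; exists (- (q * C + h * Cell)) => _ [pa _ <-].
by have := control_cost_le s pa UC; rewrite ler_norml => /andP[].
Qed.

(** Changing U by at most K changes each cost by at most |1 - c h| K, because
    interpolation is nonexpansive; an infimum is nonexpansive too. *)
Lemma dp_operator_contracting U V (K : R) :
  bounded_family U -> bounded_family V -> (forall s, `|U s - V s| <= K) ->
  forall s, `|dp_operator U s - dp_operator V s| <= q * K.
Proof.
move=> bU bV UV s; apply: inf_image_nonexpansive.
- exact: available_inhabited.
- exact: control_cost_lbound.
- exact: control_cost_lbound.
move=> pa _; rewrite opprD addrACA subrr addr0 -mulrBr normrM ler_pM//.
exact: (interp_nonexpansive Ttri Xenum betaB).
Qed.

Lemma dp_operator_bounded U : bounded_family U -> bounded_family (dp_operator U).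
Proof.
move=> bU; have [C UC] := bU; exists (q * C + h * Cell) => s.
have [pa spa] := available_inhabited s.
rewrite ler_norml; apply/andP; split.
  apply: lb_le_inf; first by exists (control_cost U s pa), pa.
  move=> _ [pb _ <-].
  by have := control_cost_le s pb UC; rewrite ler_norml => /andP[].
apply: (@le_trans _ _ (control_cost U s pa)).
  by apply: ge_inf; [exact: control_cost_lbound|exists pa].
by have := control_cost_le s pa UC; rewrite ler_norml => /andP[].
Qed.

(** The extended-real minimum in the scheme is finite at every vertex, since the
    vertex values and the running costs are bounded and some control is available
    there. *)
Lemma scheme_equation_fixpoint u : bounded_family (u \o X) ->
  scheme_equation Mc b c ell X beta h u <-> dp_operator (u \o X) =1 u \o X.
Proof.
move=> bu.
have schemeE s :
    \big[Order.min/+oo%E]_(p : comp_index J | p \in L_set Mc (X s))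
      ereal_inf [set (scheme_cost b c ell X beta h u (X s) a)%:E
        | a in [set: A p]] = (dp_operator (u \o X) s)%:E.
  rewrite bigmin_ereal_inf -ereal_inf_EFin; last 2 first.
  - exact: control_cost_lbound.
  - by have [pa spa] := available_inhabited s; exists (control_cost (u \o X) s pa), pa.
  congr ereal_inf; apply/seteqP; split=> [_ [p /= Lp [a _ <-]]|].
    exists (control_cost (u \o X) s (existT _ p a)) => //.
    by exists (existT _ p a) => //; move: Lp; rewrite inE.
  move=> _ [_ [[p a] /= Lp <-] <-].
  by exists p; [rewrite /= inE|exists a].
split=> [eqn s|fix_u s]; last by rewrite schemeE fix_u.
by have := eqn s; rewrite schemeE => -[].
Qed.

End DynamicProgramming.

Theorem proposition3p1 (R : realType) (N : nat)
    (M : 'I_N.+1 -> set 'rV[R]_N)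
    (J : 'I_N.+1 -> nat) (Mc : comp_index J -> set 'rV[R]_N)
    (A : comp_index J -> topologicalType)
    (b : forall p : comp_index J, 'rV[R]_N -> A p -> 'rV[R]_N)
    (c : comp_index J -> R)
    (ell : forall p : comp_index J, 'rV[R]_N -> A p -> R)
    (cbar : R)
    (dx : R) (T : nat -> 'I_N.+1 -> 'rV[R]_N) (X : nat -> 'rV[R]_N)
    (beta : nat -> 'rV[R]_N -> R) (h : R) :
  admissible_flat_stratification M ->
  connected_components_of M Mc ->
  standing_assumptions M Mc b ell c cbar ->
  0 < dx ->
  triangulation T ->
  nondegenerate_triangulation T dx ->
  vertex_enumeration T X ->
  basis_functions T X beta ->
  adapted_to_stratification M T X beta ->
  0 < h -> h < 1 / cbar ->
  (* i.e. `|1 - c p * h| < 1, given 0 < cbar <= c p and 0 < h; not implied by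
     h < 1 / cbar, and the conclusion can fail when c p * h = 2 *)
  (forall p : comp_index J, c p * h < 2) ->
  exists! u : 'rV[R]_N -> R,
    [/\ W_space T u, bounded_function u & scheme_equation Mc b c ell X beta h u].

Proof.
move=> Mstrat Mcomp std dx0 Ttri Tnd Xenum betaB _ h0 _ ch2.
have c_gt0 p : 0 < c p := lt_le_trans (cbar_gt0 std) (discount_ge std p).
(* The maximum is over finitely many strata, hence still less than 1. *)
pose q := \big[Num.max/0]_(p : comp_index J) `|1 - c p * h|.
have q_ge p : `|1 - c p * h| <= q by exact: le_bigmax.
have q_ge0 : 0 <= q by exact: bigmax_ge_id.
have q_lt1 : q < 1.
  apply: bigmax_lt => // p _; have := ch2 p; have := mulr_gt0 (c_gt0 p) h0.
  by rewrite ltr_norml => *; apply/andP; split; lra.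
have [Cell ell_le] : exists C, forall p x (a : A p), `|ell p x a| <= C.
  have /choice[C CP] := data_bounded std.
  exists (\big[Num.max/0]_(p : comp_index J) C p) => p x a.
  by have [_ /le_trans] := CP p x a; apply; exact: le_bigmax.
have L_inh s : L_set Mc (X s) !=set0.
  have [k _ kX] : (\bigcup_k M k) (X s) by rewrite strat_cover.
  have [j jX] := comp_cover Mcomp kX.
  by exists (existT _ k j); exact: subset_closure.
have ctrl_inh := control_nonempty std.
pose Phi := dp_operator Mc b c ell X beta h.
have Phi_contr := dp_operator_contracting b Ttri Xenum betaB h0
  q_ge ell_le ctrl_inh L_inh.
have Phi0 : bounded_family (Phi (fun=> 0)).
  apply: (dp_operator_bounded b Ttri Xenum betaB h0 q_ge ell_le ctrl_inh L_inh).
  by exists 0 => s; rewrite normr0.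
have scheme_fix := scheme_equation_fixpoint b Ttri Xenum betaB h0
  q_ge ell_le ctrl_inh L_inh.
have [U [bU fixU]] := contraction_fixpoint_exists q_ge0 q_lt1 Phi0 Phi_contr.
have interpX : interp beta U \o X = U.
  by apply/funext => s; exact: (interp_vertex betaB).
exists (interp beta U); split=> [|u [Wu [C uC] u_eqn]].
  split.
  - exact: (interp_W Ttri Xenum betaB U dx0 Tnd).
  - have [C UC] := bU; exists C => x.
    rewrite -[interp _ _ _]subr0 -(interp0 beta x).
    by apply: (interp_nonexpansive Ttri Xenum betaB) => s; rewrite subr0.
  - by apply/scheme_fix; rewrite interpX.
have buX : bounded_family (u \o X) by exists C => s; exact: uC.
rewrite -(interp_vertices Ttri Xenum betaB Wu); congr (interp beta _).
apply/funext; apply: (contraction_fixpoint_unique q_ge0 q_lt1 Phi_contr) => //.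
exact/scheme_fix.
Qed.
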